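(* Let $p\in\mathbb{C}[z_1,z_2]$ be a pure stable polynomial on $\mathbb{H}^2$ and assume $p$ vanishes to order $1$ at $(0,0)$. For any $q\in\mathbb{C}[z_1,z_2]$, the function $q/p$ is bounded on the intersection of $\mathbb{H}^2$ with some neighborhood of $(0,0)$ in $\mathbb{C}^2$ if and only if $q\in(p,\bar p)R_0$.
   Context: $\mathbb{H}$ is the open upper half plane and $\bar p(z)=\overline{p(\bar z_1,\bar z_2)}$. A polynomial $p$ is pure stable on $\mathbb{H}^2$ if it has no zeros in $\mathbb{H}^2$ and no nonconstant factor in common with $\bar p$. $R_0=\mathbb{C}\{z_1,z_2\}$ is the ring of convergent power series centered at $(0,0)$, and $(p,\bar p)R_0$ is the ideal of $R_0$ generated by $p$ and $\bar p$. *)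

(* Defs.v *)
From HB Require Import structures.
From mathcomp Require Import all_boot all_order all_algebra.
From mathcomp Require Import all_classical all_reals all_analysis.
From mathcomp Require Import complex.

Set Implicit Arguments.
Unset Strict Implicit.
Unset Printing Implicit Defensive.

Import numFieldNormedType.Exports.
Import Order.TTheory GRing.Theory Num.Theory.

Local Open Scope classical_set_scope.
Local Open Scope ring_scope.

(* R[i]^o is R[i] seen as a normed space over itself; it provides the usual
   topology on C and, through products, on C^2. *)
Notation C2 R := (R[i]^o * R[i]^o)%type.

(* C[z1, z2] is (C[z1])[z2]: the coefficient of z1^i z2^j in p is p`_j`_i. *)
Notation poly2 R := {poly {poly R[i]}}.

Section BivariatePolynomials.
Variable R : realType.
Implicit Types (p q d : poly2 R) (z : C2 R).

Definition coef2 p (i j : nat) : R[i] := p`_j`_i.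

Definition eval2 p z : R[i] := p.[z.2%:P].[z.1].

Definition conj_poly2 p : poly2 R := map_poly (map_poly (@conjc R)) p.

Lemma eval2_conj_poly2 p z :
  eval2 (conj_poly2 p) z = conjc (eval2 p (conjc z.1, conjc z.2)).
Proof.
rewrite /eval2 /conj_poly2 /= -horner_map /= conjcK; congr (_.[_]).
by rewrite -horner_map /= map_polyC /= conjcK.
Qed.

Definition constant2 p : Prop := exists c : R[i], p = c%:P%:P.

(* Exact divisibility in C[z1, z2]; the library's %| on {poly {poly _}} is
   pseudo-divisibility, i.e. divisibility over C(z1). *)
Definition divides2 d p : Prop := exists e : poly2 R, p = d * e.

Definition upper_half_bidisk : set (C2 R) :=
  [set z | 0 < complex.Im z.1 /\ 0 < complex.Im z.2].

Definition pure_stable p : Prop :=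
  (forall z, upper_half_bidisk z -> eval2 p z != 0) /\
  (forall d, divides2 d p -> divides2 d (conj_poly2 p) -> constant2 d).

Definition vanishes_to_order p (n : nat) : Prop :=
  (forall i j : nat, (i + j < n)%N -> coef2 p i j = 0) /\
  (exists i j : nat, (i + j)%N = n /\ coef2 p i j != 0).

Definition locally_bounded_ratio q p : Prop :=
  exists2 U : set (C2 R), nbhs ((0, 0) : C2 R) U &
    [bounded (eval2 q z / eval2 p z : R[i]^o) | z in U `&` upper_half_bidisk].

End BivariatePolynomials.

Section PowerSeries.
Variable R : realType.

(* Formal power series in z1, z2: a i j is the coefficient of z1^i z2^j. *)
Definition fps2 := nat -> nat -> R[i].

Definition fps2_add (a b : fps2) : fps2 := fun i j => a i j + b i j.

Definition fps2_mul (a b : fps2) : fps2 := fun i j =>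
  \sum_(k < i.+1) \sum_(l < j.+1) a k l * b (i - k)%N (j - l)%N.

(* Absolute convergence at (r, r), hence on the closed bidisk of radius r,
   for some r > 0. *)
Definition convergent_series (a : fps2) : Prop :=
  exists2 r : R, 0 < r &
    summable [set: nat * nat]
      (fun m => (complex.Re `|a m.1 m.2| * r ^+ (m.1 + m.2))%:E).

(* f belongs to (g, h)R_0, for g and h in R_0. *)
Definition in_R0_ideal (g h f : fps2) : Prop :=
  exists a b : fps2, [/\ convergent_series a, convergent_series b &
    f = fps2_add (fps2_mul a g) (fps2_mul b h)].

End PowerSeries.

(* Main.v *)
(* Up to swapping the variables, p has a nonzero z2-coefficient at the origin.
   As p and its conjugate p' have no common factor, some nonzero c(z1) lies in
   (p, p') (Gauss and resultants), so the root z2 = -s(z1) of p near 0 cannot be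
   real to arbitrarily high order: there are a real polynomial s with s(0) = 0,
   an n > 0 and b(z1) such that p(z1, -s(z1)) = b(z1) z1^n, where b(0) is not a
   real multiple of the z2-coefficient of p.  If q/p is bounded then
   |q| <= C |p| at real points near 0, and evaluating at (x, -s(x)) shows that
   z1^n divides q(z1, -s(z1)).  Thus p, p' and q are all polynomial combinations
   of z2 + s and z1^n, and Cramer's rule gives d q = f p + g p' with d(0,0)
   nonzero because of the nonreal ratio; 1/d is a Neumann series.  Conversely
   |p'| <= |p| on H^2, so membership in the ideal gives |q| <= 2 K |p|. *)
Require Import Defs.
From mathcomp Require Import all_boot all_order all_algebra.
From mathcomp Require Import all_classical all_reals all_analysis.
From mathcomp Require Import complex polyXY ring lra.

Set Implicit Arguments.
Unset Strict Implicit.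
Unset Printing Implicit Defensive.

Import numFieldNormedType.Exports.
Import Order.TTheory GRing.Theory Num.Theory.
Import ComplexField.Normc.

Local Open Scope classical_set_scope.
Local Open Scope ring_scope.
Local Open Scope complex_scope.

(** * Gauss lemma and resultants *)

Section Gauss.
Variable F : closedFieldType.
Implicit Types (c : {poly F}) (d e p q : {poly {poly F}}).

(** Over a closed field a nonconstant content has a root [a], and specializing the inner variable at
    [a] then kills every coefficient of [d]. *)
Definition primitive_poly2 d := forall a : F, map_poly (horner_eval a) d != 0.

Lemma map_horner_eval_eq0 d (a : F) :
  map_poly (horner_eval a) d = 0 -> exists e, d = e * ('X - a%:P)%:P.
Proof.
move=> d0; exists (map_poly (fun c => c %/ ('X - a%:P)) d).
apply/polyP => i; rewrite coefMC coef_map_id0 ?div0p// divpK// dvdp_XsubCl.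
by apply/eqP; rewrite -[LHS]/(horner_eval a _) -coef_map d0 coef0.
Qed.

(** Each common factor ['X - a%:P] that is pulled out lowers the degree of the leading coefficient
    by one, so the process stops. *)
Lemma primitive_part d : d != 0 ->
  exists c e, [/\ c != 0, primitive_poly2 e & d = e * c%:P].
Proof.
have [n] := ubnP (size (lead_coef d)); elim: n d => // n IHn d led d0.
have [prd|] := pselect (primitive_poly2 d).
  by exists 1, d; rewrite oner_eq0 mulr1.
move=> /existsNP[a /negP]; rewrite negbK => /eqP /map_horner_eval_eq0[e de].
have e0 : e != 0 by apply: contra_neq d0 => e0; rewrite de e0 mul0r.
have [||c [f [c0 prf ef]]] := IHn e; rewrite ?e0//.
  move: led; rewrite de lead_coefM lead_coefC size_Mmonic ?lead_coef_eq0//.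
    by rewrite size_XsubC addn2.
  exact: monicXsubC.
exists (c * ('X - a%:P)), f; split=> //; first by rewrite mulf_neq0// polyXsubC_eq0.
by rewrite de ef polyCM mulrA.
Qed.

(** The roots of [c] are cancelled one at a time: at a root [a] the product [d * e] specializes to
    zero while [d] does not, so [e] does, and ['X - a%:P] divides [e]. *)
Lemma primitive_dvd d c e p : primitive_poly2 d -> c != 0 ->
  p * c%:P = d * e -> exists f, p = d * f.
Proof.
move=> prd; have [n] := ubnP (size c); elim: n c e => // n IHn c e lec c0 pcE.
have [c1|c1] := eqVneq (size c) 1%N.
  have /size_poly1P[k k0 ck] : size c == 1%N by rewrite c1.
  exists (e * (k^-1)%:P%:P).
  by rewrite mulrA -pcE ck -mulrA -!polyCM divff// mulr1.
have /closed_rootP[a /factor_theorem[b cE]] := c1.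
have b0 : b != 0 by apply: contra_neq c0 => b0; rewrite cE b0 mul0r.
have Xa0 : ('X - a%:P)%:P != 0 :> {poly {poly F}} by rewrite polyC_eq0 polyXsubC_eq0.
have : map_poly (horner_eval a) (d * e) = 0.
  rewrite -pcE rmorphM/= map_polyC/= [horner_eval a c]/horner_eval.
  by rewrite cE hornerM hornerXsubC subrr mulr0 polyC0 mulr0.
rewrite rmorphM/= => /eqP; rewrite mulf_eq0 (negPf (prd a))/= => /eqP.
move=> /map_horner_eval_eq0[f ef]; apply: (IHn b f) => //.
  by move: lec; rewrite cE size_Mmonic ?monicXsubC// size_XsubC addn2.
by apply: (mulIf Xa0); rewrite -mulrA -polyCM -cE pcE ef mulrA.
Qed.

(* Gauss's lemma turns the lack of a common factor over F[X] into coprimality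
   over F(X), i.e. into a nonzero resultant. *)
Lemma bezout_poly2 p q : (1 < size p)%N -> (1 < size q)%N ->
  (forall d, (exists e, p = d * e) -> (exists e, q = d * e) -> (size d <= 1)%N) ->
  exists u v c, c != 0 /\ c%:P = u * p + v * q.
Proof.
move=> p1 q1 nodiv.
have [r0|r0] := eqVneq (resultant p q) 0; last first.
  have [[u v] _ E] := resultant_in_ideal p1 q1.
  by exists u, v, (resultant p q).
move/eqP : r0; rewrite resultant_eq0 => g1; exfalso.
have g0 : gcdp p q != 0 by rewrite -size_poly_gt0 (ltn_trans _ g1).
have [c [d [c0 prd gE]]] := primitive_part g0.
(* The gcd divides [f] only up to a power of its leading coefficient; passing to its primitive part
   [d] removes that factor. *)
have dvd f : gcdp p q %| f -> exists e, f = d * e.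
  rewrite Pdiv.Idomain.dvdp_eq => /eqP fE.
  apply: (@primitive_dvd _ (lead_coef (gcdp p q) ^+ scalp f (gcdp p q))
    (f %/ gcdp p q * c%:P)) => //.
    by rewrite expf_neq0// lead_coef_eq0.
  by rewrite mulrC mul_polyC fE {2}gE; ring.
have := nodiv d (dvd _ (dvdp_gcdl _ _)) (dvd _ (dvdp_gcdr _ _)).
by move: g1; rewrite gE mulrC mul_polyC size_scale// ltnNge => /negPf->.
Qed.
End Gauss.

(** * Approximating the root by real polynomials *)

Section PolynomialBounds.
Variable R : realType.
Implicit Types (f g : {poly R[i]}) (x : R).

Lemma normc_ge0 (z : R[i]) : 0 <= normc z.
Proof. by rewrite -lecR; exact: (@normr_ge0 _ R[i] z). Qed.

Lemma normc_gt0 (z : R[i]) : (0 < normc z) = (z != 0).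
Proof. by rewrite -ltcR; exact: (@normr_gt0 _ R[i] z). Qed.

Lemma normc_real x : normc x%:C = `|x|.
Proof. by rewrite /= expr0n addr0 sqrtr_sqr. Qed.

Lemma poly_bounded f : exists2 M : R, 0 <= M &
  forall z, normc z <= 1 -> normc f.[z] <= M.
Proof.
elim/poly_ind: f => [|f c [M M0 IH]].
  by exists 0 => // z _; rewrite horner0 normc0.
exists (M + normc c) => [|z z1]; first by rewrite addr_ge0// normc_ge0.
rewrite hornerMXaddC (le_trans (le_normcD _ _))// lerD2r normcM.
by rewrite -[leRHS]mulr1 ler_pM ?normc_ge0// IH.
Qed.

Lemma poly_lipschitz0 f : exists2 M : R, 0 <= M &
  forall z, normc z <= 1 -> normc (f.[z] - f.[0]) <= M * normc z.
Proof.
elim/poly_ind: f => [|f c _].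
  by exists 0 => // z _; rewrite !horner0 subr0 normc0 mul0r.
have [M M0 fM] := poly_bounded f; exists M => // z z1.
rewrite !hornerMXaddC mulr0 add0r addrK normcM ler_wpM2r ?normc_ge0//.
exact: fM.
Qed.

(** Passage to the limit as [x] tends to 0 from the right, made explicit by Lipschitz constants at
    0. *)
Lemma poly_le_at0 f g (C d : R) : 0 <= C -> 0 < d ->
  (forall x, 0 < x < d -> normc g.[x%:C] <= C * normc f.[x%:C]) ->
  normc g.[0] <= C * normc f.[0].
Proof.
move=> C0 d0 gf; apply/ler_addgt0Pr => e e0.
have [M M0 fM] := poly_lipschitz0 f; have [N N0 gN] := poly_lipschitz0 g.
pose K := C * M + N + 1.
have K0 : 0 < K by rewrite ltr_pwDr// addr_ge0// mulr_ge0.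
(* At distance [x] the two Lipschitz errors add up to at most [(C * M + N) * x], hence to at most
   [e]. *)
pose x := Num.min (d / 2) (Num.min 1 (e / K)).
have x0 : 0 < x by rewrite !lt_min divr_gt0//= ltr01/= divr_gt0.
have xd : x < d by rewrite gt_min ltr_pdivrMr// mulr2n mulrDr mulr1 ltrDl d0.
have x1 : normc x%:C <= 1 by rewrite normc_real gtr0_norm// !ge_min lexx orbT.
have xK : K * x <= e by rewrite mulrC -ler_pdivlMr// !ge_min lexx !orbT.
have nx : normc x%:C = x by rewrite normc_real gtr0_norm.
have h1 : normc g.[0] <= normc g.[x%:C] + N * x.
  rewrite -[X in normc X <= _](subKr g.[x%:C]) (le_trans (le_normcD _ _))//.
  by rewrite normcN lerD2l -[X in N * X]nx gN.
have h2 : normc f.[x%:C] <= normc f.[0] + M * x.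
  rewrite -[X in normc X <= _](subrK f.[0]) (le_trans (le_normcD _ _))//.
  by rewrite addrC lerD2l -[X in M * X]nx fM.
have h3 := gf x; rewrite x0 xd in h3; have {}h3 := h3 isT.
have h4 := ler_wpM2l C0 h2.
rewrite /K in xK; nra.
Qed.

(** One factor at a time: once [g = h * 'X^n], cancelling [x ^+ n] and letting [x] tend to 0 bounds
    [h.[0]] by a multiple of [(f * 'X).[0] = 0]. *)
Lemma divXn_of_bound f g n (C d : R) : 0 <= C -> 0 < d ->
  (forall x, 0 < x < d ->
    normc g.[x%:C] <= C * normc (f * 'X^n).[x%:C]) ->
  exists h, g = h * 'X^n.
Proof.
move=> C0 d0; elim: n f => [|n IHn] f gf; first by exists g; rewrite mulr1.
have [|h gh] := IHn (f * 'X).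
  by move=> x xd; rewrite -mulrA -exprS gf.
have : normc h.[0] <= C * normc (f * 'X).[0].
  apply: poly_le_at0 d0 _ => // x xd; move: (gf x xd).
  rewrite gh exprS mulrA !(hornerM _ 'X^n) !(normcM _ 'X^n.[_]) mulrA ler_pM2r//.
  by rewrite hornerXn -rmorphXn normc_real normrX exprn_gt0// gtr0_norm;
    case/andP: xd.
rewrite hornerM hornerX mulr0 normc0 mulr0 => h0.
have /eqP/factor_theorem[k hk] : h.[0] = 0.
  by apply: eq0_normc; apply/le_anti; rewrite h0 normc_ge0.
by exists k; rewrite gh hk subr0 exprS mulrA.
Qed.
End PolynomialBounds.

Section RealRoot.
Variable R : realType.
Implicit Types (p q : poly2 R) (v : {poly R[i]}) (s : {poly R}).

Local Notation toC := (map_poly (real_complex R)).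

Lemma horner_poly2 (A : comNzRingType) (p : {poly {poly A}}) (v : {poly A}) (x : A) :
  p.[v].[x] = p.[v.[x]%:P].[x].
Proof.
elim/poly_ind: p => [|p c IH]; first by rewrite !horner0.
by rewrite !hornerMXaddC !hornerE IH.
Qed.

Lemma horner_poly2_0 p v : v`_0 = 0 -> p.[v]`_0 = p`_0`_0.
Proof.
by rewrite -!horner_coef0 => v0; rewrite horner_poly2 v0 polyC0 horner_coef0.
Qed.

Lemma poly2_divXsub p v : exists e, p = e * ('X - v%:P) + p.[v]%:P.
Proof.
have /factor_theorem[e E] : root (p - p.[v]%:P) v.
  by rewrite /root hornerD hornerN hornerC subrr.
by exists e; rewrite -E subrK.
Qed.

(** Comparison of the coefficients of z2 at z1 = 0, where [v] vanishes. *)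
Lemma coef1_divXsub p e v : v`_0 = 0 -> p = e * ('X - v%:P) + p.[v]%:P ->
  e`_0`_0 = p`_1`_0.
Proof.
move=> v0 ->; rewrite mulrBr coefD coefB coefMX coefMC coefC/= addr0.
by rewrite coefB -!horner_coef0 hornerM (horner_coef0 v) v0 mulr0 subr0.
Qed.

(* Approximating the root z2 = -s(z1) of p: either some coefficient is the
   first nonreal one, or the approximation by real polynomials goes on. *)
Lemma real_root_approx p n : p`_0`_0 = 0 -> p`_1`_0 != 0 ->
  (exists s b, s`_0 = 0 /\ p.[- toC s] = b * 'X^(n.+1)) \/
  (exists s b m, [/\ s`_0 = 0, p.[- toC s] = b * 'X^(m.+1) &
     complex.Im (b`_0 / p`_1`_0) != 0]).
Proof.
move=> p00 p10; elim: n => [|n [[s [b [s0 pb]]]|]]; last by right.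
  left; have /eqP/factor_theorem[b pb] : (p`_0).[0] = 0 by rewrite horner_coef0 p00.
  by exists 0, b; rewrite coef0 rmorph0 oppr0 horner_coef0 pb polyC0 subr0 expr1.
have [Im0|Im_neq0] := eqVneq (complex.Im (b`_0 / p`_1`_0)) 0; last first.
  by right; exists s, b, n.
have [c cE] : exists c : R, b`_0 = c%:C * p`_1`_0.
  exists (complex.Re (b`_0 / p`_1`_0)); rewrite -[LHS](divfK p10); congr (_ * _).
  by case: (_ / _) Im0 => x y /= ->.
(* Since the ratio [c] is real, [s] can be corrected within the real polynomials; the new term
   cancels the coefficient of order [n.+1], because the cofactor [e] takes the value [p]_1[_0] at
   the origin. *)
left; pose t := s + c *: 'X^(n.+1).
have t0 : t`_0 = 0 by rewrite coefD s0 coefZ coefXn mulr0 addr0.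
have toC0 (u : {poly R}) : u`_0 = 0 -> (- toC u)`_0 = 0.
  by move=> u0; rewrite coefN coef_map/= u0 oppr0.
have [e pe] := poly2_divXsub p (- toC s).
have pt : p.[- toC t] = (b - c%:C *: e.[- toC t]) * 'X^(n.+1).
  rewrite pe !hornerE pb rmorphD/= map_polyZ/= map_polyXn -!mul_polyC; ring.
have : (b - c%:C *: e.[- toC t]).[0] = 0.
  rewrite horner_coef0 coefB coefZ horner_poly2_0 ?toC0//.
  by rewrite (coef1_divXsub _ pe) ?toC0// cE subrr.
move=> /eqP/factor_theorem[b' b'E].
by exists t, b'; split=> //; rewrite pt b'E polyC0 subr0 [in RHS]exprS mulrA.
Qed.
End RealRoot.

(** * Restriction to a real curve and Cramer's rule *)

Section CramerReduction.
Variable R : realType.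
Implicit Types p q d : poly2 R.

Local Notation toC := (map_poly (real_complex R)).

(** The bound is written without a quotient because [p] may vanish at real points, in particular at
    the origin. *)
Definition real_bound q p := exists C r : R, [/\ 0 <= C, 0 < r &
  forall x y : R, `|x| < r -> `|y| < r ->
    normc (eval2 q (x%:C, y%:C)) <= C * normc (eval2 p (x%:C, y%:C))].

Definition no_common_factor p q :=
  forall d, divides2 d p -> divides2 d q -> constant2 d.

Lemma conj_toC (s : {poly R}) : map_poly (@conjc R) (toC s) = toC s.
Proof. by apply/polyP => i; rewrite !coef_map/= oppr0. Qed.

Lemma horner_conj_poly2 p (s : {poly R}) :
  (conj_poly2 p).[- toC s] = map_poly (@conjc R) p.[- toC s].
Proof. by rewrite -(horner_map (map_poly (@conjc R)))/= rmorphN/= conj_toC. Qed.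

Lemma real_bound_divXn p q (s : {poly R}) b n : real_bound q p -> s`_0 = 0 ->
  p.[- toC s] = b * 'X^n -> exists e, q.[- toC s] = e * 'X^n.
Proof.
move=> [C [r [C0 r0 qp]]] s0 pb.
have [M M0 sM] := poly_lipschitz0 (toC s).
have M10 : 0 < M + 1 by rewrite ltr_pwDr.
(* With this radius both [x] and [s.[x]], the latter at most [M * x] in absolute value, stay below
   [r]. *)
apply: (@divXn_of_bound _ b _ _ C (Num.min 1 (r / (M + 1)))) => //.
  by rewrite lt_min ltr01 divr_gt0.
move=> x /andP[x0]; rewrite lt_min ltr_pdivlMr// => /andP[x1 xr].
have nx : normc x%:C = x by rewrite normc_real gtr0_norm.
have := sM x%:C; rewrite nx => /(_ (ltW x1)).
rewrite !horner_coef0 coef_map/= s0 subr0 horner_map normc_real => sxM.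
rewrite -pb (horner_poly2 q) (horner_poly2 p) hornerN horner_map -rmorphN.
by apply: qp; [rewrite gtr0_norm//|rewrite normrN]; nra.
Qed.

(** The right-hand expression is -2i |w|^2 Im(z/w). It is the value at the origin of the determinant
    in [cramer_reduction]. *)
Lemma Im_divr (z w : R[i]) : w != 0 ->
  (complex.Im (z / w) != 0) = (w * z^* - w^* * z != 0).
Proof.
move=> w0; rewrite -[in RHS](divfK w0 z); move: (z / w) => [x y].
have -> : w * ((x +i* y) * w)^* - w^* * ((x +i* y) * w) =
    (w * w^*) * (0 +i* (- (2 * y))).
  rewrite rmorphM/=; move: w {w0} => [u v]; apply/eqP.
  by rewrite eq_complex; simpc => /=; apply/andP; split; apply/eqP; ring.
rewrite !mulf_eq0 conjc_eq0 (negPf w0)/= eq_complex/= eqxx/= oppr_eq0.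
by rewrite mulf_eq0 pnatr_eq0.
Qed.

Lemma cramer_reduction p q :
  p`_0`_0 = 0 -> p`_1`_0 != 0 -> no_common_factor p (conj_poly2 p) ->
  real_bound q p ->
  exists d a b, d`_0`_0 != 0 /\ d * q = a * p + b * conj_poly2 p.
Proof.
move=> p00 p10 nocf qp; set pc := conj_poly2 p.
have size_gt1 (f : poly2 R) : f`_1`_0 != 0 -> (1 < size f)%N.
  by apply: contraNltn => f1; rewrite (nth_default _ f1) coef0.
have pc10 : pc`_1`_0 != 0 by rewrite /pc /conj_poly2 !coef_map/= conjc_eq0.
have [|u [v [c [c0 cE]]]] := bezout_poly2 (size_gt1 _ p10) (size_gt1 _ pc10).
  by move=> d dp dpc; have [k ->] := nocf d dp dpc; exact: size_polyC_leq1.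
(* A real approximation of order [(size c).+1] is excluded: [p] and its conjugate would both be
   divisible by that power of z1 on the real curve, hence so would the nonzero [c]. *)
have [[s [b [s0 pb]]]|[s [b [m [s0 pb bIm]]]]] :=
    real_root_approx (size c) p00 p10.
  have : (c%:P).[- toC s] = (u.[- toC s] * b +
      v.[- toC s] * map_poly (@conjc R) b) * 'X^((size c).+1).
    rewrite cE hornerD !hornerM horner_conj_poly2 pb rmorphM/= map_polyXn; ring.
  rewrite hornerC => cX.
  suff : (size c < size c)%N by rewrite ltnn.
  rewrite [in ltnRHS]cX size_mulXn ?leq_addr//.
  by apply: contra_neq c0 => w0; rewrite cX w0 mul0r.
have v0 : (- toC s)`_0 = 0 by rewrite coefN coef_map/= s0 oppr0.
have [e qe] := real_bound_divXn qp s0 pb.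
have [f qf] := poly2_divXsub q (- toC s).
have [a pa] := poly2_divXsub p (- toC s).
have a00 := coef1_divXsub v0 pa.
pose ac := conj_poly2 a; pose bc := map_poly (@conjc R) b.
have pca : pc = ac * ('X + (toC s)%:P) + (bc * 'X^(m.+1))%:P.
  rewrite /pc {1}pa /conj_poly2 rmorphD rmorphM rmorphB/= map_polyX !map_polyC/=.
  by rewrite rmorphN/= conj_toC polyCN opprK pb rmorphM/= map_polyXn.
(* Cramer's rule for the expressions of [p], [pc] and [q] through z2 + s and z1^(m+1), whose
   coefficient pairs are (a, b), (ac, bc) and (f, e). *)
exists (a * bc%:P - ac * b%:P), (f * bc%:P - e%:P * ac), (e%:P * a - f * b%:P).
split.
  rewrite coefB !coefMC coefB -!horner_coef0 !hornerM !horner_coef0.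
  by rewrite !coef_map/= a00 -Im_divr.
rewrite qf qe -/pc pca [in X in _ = _ * X + _]pa pb !polyCM polyCN; ring.
Qed.
End CramerReduction.

(** * Boundedness at real points *)

Section Swap.
Variable R : realType.
Implicit Types p q d : poly2 R.

Lemma conj_poly2_swapXY p : conj_poly2 (swapXY p) = swapXY (conj_poly2 p).
Proof. by rewrite /conj_poly2 swapXY_map. Qed.

Lemma eval2_swapXY p z : eval2 (swapXY p) z = eval2 p (z.2, z.1).
Proof. exact: horner2_swapXY. Qed.

Lemma no_common_factor_swapXY p q :
  no_common_factor p q -> no_common_factor (swapXY p) (swapXY q).
Proof.
have dvd d f : divides2 d (swapXY f) -> divides2 (swapXY d) f.
  by move=> [e fE]; exists (swapXY e); rewrite -rmorphM/= -fE swapXYK.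
move=> nocf d dp dq; have [c dc] := nocf _ (dvd _ _ dp) (dvd _ _ dq).
by exists c; rewrite -[d]swapXYK dc swapXY_polyC map_polyC.
Qed.

Lemma real_bound_swapXY p q : real_bound q p -> real_bound (swapXY q) (swapXY p).
Proof.
move=> [C [r [C0 r0 qp]]]; exists C, r; split=> // x y xr yr.
by rewrite !eval2_swapXY; exact: qp.
Qed.

Lemma bounded_reduction p q :
  vanishes_to_order p 1 -> no_common_factor p (conj_poly2 p) ->
  real_bound q p ->
  exists d a b, d`_0`_0 != 0 /\ d * q = a * p + b * conj_poly2 p.
Proof.
move=> [p0 [i [j [ij pij]]]] nocf qp.
have p00 : p`_0`_0 = 0 by exact: p0.
(* If the nonzero linear coefficient is that of z1, the variables are exchanged; if it is that of
   z2, the reduction applies directly. *)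
case: j ij pij => [|[|j]]; last by rewrite !addnS.
  rewrite addn0 => -> p01.
  have [||||d [a [b [d0 dE]]]] := @cramer_reduction R (swapXY p) (swapXY q).
  - by rewrite coef_swapXY.
  - by rewrite coef_swapXY.
  - by rewrite conj_poly2_swapXY; exact: no_common_factor_swapXY.
  - exact: real_bound_swapXY.
  exists (swapXY d), (swapXY a), (swapXY b); split; first by rewrite coef_swapXY.
  move: (congr1 swapXY dE).
  by rewrite conj_poly2_swapXY rmorphD !rmorphM/= !swapXYK.
rewrite addn1 => -[->] p10; exact: cramer_reduction.
Qed.
End Swap.

(** * From bounds on the bidisk in the upper half planes to bounds at real points *)

Section LocalBound.
Variable R : realType.
Implicit Types p q : poly2 R.

Lemma normcE_norm (z : R[i]) : `|z| = (normc z)%:C.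
Proof. by []. Qed.

Lemma nbhs_bidiskP (U : set (C2 R)) : nbhs ((0, 0) : C2 R) U <->
  exists2 r : R, 0 < r &
    forall z : C2 R, normc z.1 < r -> normc z.2 < r -> U z.
Proof.
split=> [[[A B] [/= /nbhs_ballP[a a0 aA] /nbhs_ballP[b b0 bB]] ABU]|[r r0 rU]].
  have ballE (c : R[i]) : 0 < c -> exists2 r : R, 0 < r & c = r%:C.
    (* Radii of balls lie in [R[i]]; being positive there forces a zero imaginary part. *)
    move: c => [x y]; rewrite ltcE/= => /andP[/eqP -> x0].
    by exists x.
  have [a' a'0 aE] := ballE a a0; have [b' b'0 bE] := ballE b b0.
  exists (Num.min a' b') => [|[z w] /=]; first by rewrite lt_min a'0.
  rewrite !lt_min => /andP[za _] /andP[_ wb]; apply: ABU; split=> /=.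
    by apply: aA; rewrite -ball_normE/= sub0r normrN aE normcE_norm ltcR.
  by apply: bB; rewrite -ball_normE/= sub0r normrN bE normcE_norm ltcR.
have r0C : 0 < r%:C :> R[i] by rewrite ltcR.
exists (ball (0 : R[i]^o) r%:C, ball (0 : R[i]^o) r%:C) => /=.
  by split; apply: nbhsx_ballx.
move=> [z w] [/= zr wr]; apply: rU => /=.
  by move: zr; rewrite -ball_normE/= sub0r normrN normcE_norm ltcR.
by move: wr; rewrite -ball_normE/= sub0r normrN normcE_norm ltcR.
Qed.

Lemma locally_bounded_ratioP p q :
  (forall z, upper_half_bidisk z -> eval2 p z != 0) ->
  locally_bounded_ratio q p <->
  exists C r : R, [/\ 0 <= C, 0 < r & forall z : C2 R,
    upper_half_bidisk z -> normc z.1 < r -> normc z.2 < r ->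
    normc (eval2 q z) <= C * normc (eval2 p z)].
Proof.
move=> pH; split=> [[U /nbhs_bidiskP[r r0 rU] [M [Mreal MU]]]|[C [r [C0 r0 Cr]]]].
  (* Boundedness supplies a bound for every number strictly above the real [M], whence the added
     1. *)
  exists (`|complex.Re M| + 1), r; split=> // z zH z1 z2.
  have /MU/(_ z)/= : M < (`|complex.Re M| + 1)%:C.
    move: Mreal => {MU}; move: M => [x y]; rewrite complex_real/= => /eqP ->.
    by rewrite ltcR (le_lt_trans (ler_norm _))// ltrDl.
  move=> /(_ (conj (rU _ z1 z2) zH)).
  rewrite normcE_norm lecR normcM normcV ler_pdivrMr//.
  by rewrite normc_gt0 pH.
exists [set z | normc z.1 < r /\ normc z.2 < r].
  by apply/nbhs_bidiskP; exists r.
exists C%:C; split=> [|M CM z [[/= z1 z2] zH]]; first by rewrite complex_real.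
apply: le_trans (ltW CM); rewrite normcE_norm lecR normcM normcV.
rewrite ler_pdivrMr ?Cr//.
by rewrite normc_gt0 pH.
Qed.

Definition curve_poly p (u v : {poly R[i]}) := (map_poly (comp_poly u) p).[v].

Lemma horner_curve_poly p u v t :
  (curve_poly p u v).[t] = eval2 p (u.[t], v.[t]).
Proof.
rewrite /curve_poly /eval2/=; elim/poly_ind: p => [|p c IH].
  by rewrite rmorph0 !horner0.
rewrite rmorphD rmorphM/= map_polyX map_polyC/= !hornerE IH.
by rewrite horner_comp.
Qed.

(** The real point (x, y) is the limit of (x + it, y + it) as t decreases to 0, and both polynomials
    restrict to polynomials in t. Halving [r] keeps these points in the bidisk. *)
Lemma real_bound_of_locally_bounded p q :
  (forall z, upper_half_bidisk z -> eval2 p z != 0) ->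
  locally_bounded_ratio q p -> real_bound q p.
Proof.
move=> pH /(locally_bounded_ratioP _ pH)[C [r [C0 r0 Cr]]].
exists C, (r / 2); split=> // [|x y xr yr]; first by rewrite divr_gt0.
pose u (a : R) : {poly R[i]} := a%:C%:P + 'i%C *: 'X.
have uE a t : (u a).[t%:C] = a +i* t.
  by rewrite /u !hornerE; simpc.
have u0 a : (u a).[0] = a%:C by rewrite (uE _ 0).
have norm_u a t : 0 < t < r / 2 -> `|a| < r / 2 -> normc (a +i* t) < r.
  move=> /andP[t0 tr] ar.
  have -> : a +i* t = a%:C + t%:C * 'i%C by simpc.
  rewrite (le_lt_trans (le_normcD _ _))// normcM !normc_real (gtr0_norm t0).
  by rewrite /= expr0n/= expr1n add0r sqrtr1 mulr1; lra.
have := @poly_le_at0 R (curve_poly p (u x) (u y)) (curve_poly q (u x) (u y))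
  C (r / 2) C0; rewrite !horner_curve_poly !u0; apply; first by rewrite divr_gt0.
move=> t tr; rewrite !horner_curve_poly !uE; apply: Cr.
- by case/andP: tr.
- exact: norm_u.
- exact: norm_u.
Qed.
End LocalBound.

(** * Weighted norms of polynomials and power series *)

Section WeightedNorm.
Variable R : realType.

(** An abstract class of norms stable under [wnorm], so that one argument serves both variables of
    [norm2]. *)
Record submult_seminorm (V : nzRingType) (nu : V -> R) : Prop := {
  seminorm0 : nu 0 = 0;
  seminorm_ge0 : forall x, 0 <= nu x;
  seminormD : forall x y, nu (x + y) <= nu x + nu y;
  seminormM : forall x y, nu (x * y) <= nu x * nu y }.

Lemma normc_submult : submult_seminorm (@normc R).
Proof.
split=> [|||x y]; [exact: normc0|exact: normc_ge0|exact: le_normcD|].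
by rewrite normcM.
Qed.

Definition wnorm (V : nzRingType) (nu : V -> R) (r : R) (f : {poly V}) : R :=
  \sum_(i < size f) nu f`_i * r ^+ i.

Section WeightedNormTheory.
Variables (V : nzRingType) (nu : V -> R) (r : R).
Hypotheses (nuS : submult_seminorm nu) (r0 : 0 <= r).
Implicit Types f g : {poly V}.

Lemma wnorm_widen f n : (size f <= n)%N ->
  wnorm nu r f = \sum_(i < n) nu f`_i * r ^+ i.
Proof.
move=> fn; rewrite /wnorm (big_ord_widen n (fun i => nu f`_i * r ^+ i))// big_mkcond/=.
apply: eq_bigr => i _; case: ltnP => // fi.
by rewrite nth_default// (seminorm0 nuS) mul0r.
Qed.

Lemma wnormC c : wnorm nu r c%:P = nu c.
Proof.
rewrite (wnorm_widen (size_polyC_leq1 c)) big_ord_recl big_ord0 addr0.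
by rewrite coefC expr0 mulr1.
Qed.

Lemma wnormMXaddC f c : wnorm nu r (f * 'X + c%:P) = r * wnorm nu r f + nu c.
Proof.
have sz : (size (f * 'X + c%:P)%R <= (size f).+1)%N.
  by rewrite size_MXaddC; case: ifP.
rewrite (wnorm_widen sz) big_ord_recl/= coefD coefMX coefC/= add0r expr0 mulr1.
rewrite addrC; congr (_ + _); rewrite mulr_sumr; apply: eq_bigr => i _.
by rewrite /bump/= coefD coefMX coefC/= addr0 exprS mulrCA.
Qed.

Lemma wnormD f g : wnorm nu r (f + g) <= wnorm nu r f + wnorm nu r g.
Proof.
pose n := maxn (size f) (size g).
have fn : (size f <= n)%N by exact: leq_maxl.
have gn : (size g <= n)%N by exact: leq_maxr.
rewrite (wnorm_widen fn) (wnorm_widen gn) (@wnorm_widen _ n); last exact: size_polyD.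
rewrite -big_split/= ler_sum// => i _.
by rewrite coefD -mulrDl ler_wpM2r ?exprn_ge0// (seminormD nuS).
Qed.

Lemma wnorm_ge0 f : 0 <= wnorm nu r f.
Proof.
by apply: sumr_ge0 => i _; rewrite mulr_ge0 ?exprn_ge0 ?(seminorm_ge0 nuS).
Qed.

Lemma wnorm_submult : submult_seminorm (wnorm nu r).
Proof.
split=> [|||f g]; [by rewrite -polyC0 wnormC (seminorm0 nuS)|exact: wnorm_ge0|
  exact: wnormD|].
elim/poly_ind: f => [|f c IH].
  by rewrite mul0r -polyC0 wnormC (seminorm0 nuS) mul0r.
have -> : (f * 'X + c%:P) * g = ((f * g) * 'X + 0%:P) + c *: g.
  by rewrite polyC0 addr0 mulrDl mul_polyC -!mulrA commr_polyX.
rewrite (le_trans (wnormD _ _))// !wnormMXaddC (seminorm0 nuS) addr0 mulrDl.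
rewrite lerD// -?mulrA ?ler_wpM2l//.
rewrite (wnorm_widen (size_scale_leq c g)) /wnorm mulr_sumr ler_sum// => i _.
by rewrite coefZ mulrA ler_wpM2r ?exprn_ge0// (seminormM nuS).
Qed.
End WeightedNormTheory.

Definition norm2 (r : R) : poly2 R -> R := wnorm (wnorm (@normc R) r) r.

Lemma norm2_submult r : 0 <= r -> submult_seminorm (norm2 r).
Proof. by move=> r0; do 2!apply: wnorm_submult => //; exact: normc_submult. Qed.

Lemma norm2_1 r : 0 <= r -> norm2 r 1 = 1.
Proof.
move=> r0; have nS := normc_submult; rewrite /norm2 -!polyC1 wnormC.
  by rewrite wnormC ?normc1.
exact: wnorm_submult.
Qed.

Lemma norm2N r p : norm2 r (- p) = norm2 r p.
Proof.
rewrite /norm2 /wnorm size_polyN; apply: eq_bigr => i _; congr (_ * _).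
rewrite coefN size_polyN; apply: eq_bigr => j _; congr (_ * _).
by rewrite coefN normcN.
Qed.

Lemma eval2_le_norm2 r (p : poly2 R) (z : C2 R) : 0 <= r ->
  normc z.1 <= r -> normc z.2 <= r -> normc (eval2 p z) <= norm2 r p.
Proof.
move=> r0 z1 z2; have wS := wnorm_submult normc_submult r0.
rewrite /eval2 /norm2; elim/poly_ind: p => [|p c IH].
  by rewrite !horner0 normc0 wnorm_ge0.
rewrite wnormMXaddC// !hornerE (le_trans (le_normcD _ _))// lerD//.
  rewrite normcM [leRHS]mulrC ler_pM ?normc_ge0//.
elim/poly_ind: c => [|c a IHc].
  by rewrite !horner0 normc0 wnorm_ge0//; exact: normc_submult.
rewrite wnormMXaddC//; last exact: normc_submult.
rewrite !hornerE (le_trans (le_normcD _ _))// lerD2r.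
by rewrite normcM [leRHS]mulrC ler_pM ?normc_ge0.
Qed.

End WeightedNorm.

(** * Coefficient sums over squares and convergence *)

Section SquareSums.
Variable R : realType.
Implicit Types (a b : fps2 R) (p q : poly2 R).

Definition square_sum (r : R) (n : nat) (a : fps2 R) : R :=
  \sum_(j < n) \sum_(i < n) normc (a i j) * r ^+ (i + j).

Lemma norm2E r p n : 0 <= r -> (size p <= n)%N -> (sizeY p <= n)%N ->
  norm2 r p = square_sum r n (coef2 p).
Proof.
move=> r0 pn pYn; have nS := normc_submult R.
rewrite /norm2 (wnorm_widen r (wnorm_submult nS r0) pn).
apply: eq_bigr => j _.
rewrite (wnorm_widen r nS (leq_trans (max_size_coefXY p j) pYn)) mulr_suml.
by apply: eq_bigr => i _; rewrite exprD mulrA.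
Qed.

Lemma square_sum_le r m n a : 0 <= r -> (m <= n)%N ->
  square_sum r m a <= square_sum r n a.
Proof.
move=> r0 mn; rewrite /square_sum.
have ge0 i j : 0 <= normc (a i j) * r ^+ (i + j).
  by rewrite mulr_ge0 ?normc_ge0 ?exprn_ge0.
rewrite (big_ord_widen n (fun j => \sum_(i < m) normc (a i j) * r ^+ (i + j)) mn).
rewrite big_mkcond/= ler_sum// => j _.
case: ifP => _; last by rewrite sumr_ge0.
rewrite (big_ord_widen n (fun i => normc (a i j) * r ^+ (i + j)) mn).
by rewrite big_mkcond/= ler_sum// => i _; case: ifP.
Qed.

Lemma square_sum_le_norm2 r n p : 0 <= r -> square_sum r n (coef2 p) <= norm2 r p.
Proof.
move=> r0; rewrite (@norm2E r p (maxn n (maxn (size p) (sizeY p)))) //.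
- by rewrite square_sum_le// leq_maxl.
- by rewrite !leq_max leqnn orbT.
- by rewrite !leq_max leqnn !orbT.
Qed.

Lemma square_sum_radius r s n a : 0 <= r <= s ->
  square_sum r n a <= square_sum s n a.
Proof.
move=> /andP[r0 rs]; apply: ler_sum => j _; apply: ler_sum => i _.
by rewrite ler_wpM2l ?normc_ge0// lerXn2r// nnegrE// (le_trans r0).
Qed.

Definition order_ge n a := forall i j, (i + j < n)%N -> a i j = 0.

(** Each surviving monomial has total degree at least [n], so shrinking the radius gains at least
    [t ^+ n]. *)
Lemma norm2_shrink t r n p : 0 <= t <= 1 -> 0 <= r -> order_ge n (coef2 p) ->
  norm2 (t * r) p <= t ^+ n * norm2 r p.
Proof.
move=> /andP[t0 t1] r0 pn; pose m := maxn (size p) (sizeY p).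
rewrite !(@norm2E _ p m) ?leq_maxl ?leq_maxr ?mulr_ge0// mulr_sumr.
apply: ler_sum => j _; rewrite mulr_sumr; apply: ler_sum => i _.
have [ij|ij] := ltnP (i + j) n; first by rewrite pn// normc0 !mul0r mulr0.
rewrite mulrCA ler_wpM2l ?normc_ge0// exprMn ler_wpM2r ?exprn_ge0//.
by rewrite ler_wiXn2l.
Qed.

Lemma fps2_mul_coef2 p q : fps2_mul (coef2 p) (coef2 q) = coef2 (p * q).
Proof.
apply/funext => i; apply/funext => j; rewrite /coef2 /fps2_mul coefM coef_sum.
by rewrite exchange_big/=; apply: eq_bigr => l _; rewrite coefM.
Qed.

Lemma order_ge_mul m n p q : order_ge m (coef2 p) -> order_ge n (coef2 q) ->
  order_ge (m + n) (coef2 (p * q)).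
Proof.
move=> pm qn i j ij; rewrite -fps2_mul_coef2 /fps2_mul.
apply: big1 => k _; apply: big1 => l _.
have [kl|kl] := ltnP (k + l) m; first by rewrite pm// mul0r.
rewrite qn ?mulr0// -(ltn_add2l m) (leq_ltn_trans _ ij)//.
have := ltn_ord k; have := ltn_ord l; move: kl; rewrite !ltnS => kl lj ki.
rewrite (leq_trans (leq_add kl (leqnn _)))// addnACA.
by rewrite !subnKC.
Qed.

Lemma eq_fps2_mul a a' b i j :
  (forall k l, (k <= i)%N -> (l <= j)%N -> a k l = a' k l) ->
  fps2_mul a b i j = fps2_mul a' b i j.
Proof.
move=> aa'; apply: eq_bigr => k _; apply: eq_bigr => l _.
by rewrite aa'// -ltnS ltn_ord.
Qed.

(** Squares of indices are cofinal among finite index sets, so bounding the square sums bounds all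
    finite sums. *)
Lemma convergent_seriesP a : convergent_series a <->
  exists r K : R, 0 < r /\ forall n, square_sum r n a <= K.
Proof.
pose sq n := [seq (i, j) | j <- index_iota 0 n, i <- index_iota 0 n].
have square_fsum r n : 0 <= r -> (square_sum r n a)%:E =
    (\sum_(m \in [set` sq n])
      `|(complex.Re `|a m.1 m.2| * r ^+ (m.1 + m.2))%:E|)%E.
  move=> r0; rewrite -fsbig_seq; last first.
    by rewrite allpairs_uniq ?iota_uniq// => -[i j] [k l] _ _ [-> ->].
  rewrite big_allpairs_dep -sumEFin big_mkord.
  apply: eq_bigr => j _; rewrite big_mkord -sumEFin; apply: eq_bigr => i _ /=.
  by rewrite ger0_norm// mulr_ge0 ?normc_ge0 ?exprn_ge0.
split=> [[r r0 ra]|[r [K [r0 aK]]]].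
  have : \esum_(m in [set: nat * nat])
      `|(complex.Re `|a m.1 m.2| * r ^+ (m.1 + m.2))%:E|%E \is a fin_num.
    by rewrite -summableE.
  move=> afin; exists r; exists (fine (\esum_(m in [set: nat * nat])
      `|(complex.Re `|a m.1 m.2| * r ^+ (m.1 + m.2))%:E|%E)); split=> // n.
  rewrite -lee_fin fineK// square_fsum ?(ltW r0)//.
  by apply: esum_ge; exists [set` sq n] => //; split=> //; exact: finite_seq.
exists r => //; apply: (@le_lt_trans _ _ K%:E); last exact: ltry.
apply: ge_ereal_sup => _ [A [/finite_seqP[s ->] _] <-].
pose n := (\max_(m <- s) (maxn m.1 m.2)).+1.
apply: (@le_trans _ _ (square_sum r n a)%:E); last by rewrite lee_fin.
rewrite square_fsum ?(ltW r0)//; apply: lee_fsum_nneg_subset => //;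
  try exact: finite_seq.
move=> m; rewrite inE/= => ms; rewrite inE/=.
have mn : (maxn m.1 m.2 < n)%N.
  by rewrite ltnS (@leq_bigmax_seq _ _ xpredT (fun m => maxn m.1 m.2) m).
apply/allpairsP; exists (m.2, m.1) => /=; rewrite !mem_index_iota/=.
by move: mn; rewrite gtn_max => /andP[-> ->]; split=> //; case: (m).
Qed.

End SquareSums.

(** * Bounded ratios and ideal membership *)

Section ConjugateBound.
Variable R : realType.
Implicit Types p q : poly2 R.

Lemma normcJ_eq (z : R[i]) : normc z^* = normc z.
Proof. by case: z => x y; rewrite /= sqrrN. Qed.

(** Every root lies in the closed lower half plane, hence is at least as close to -i as to i; the
    distances are multiplied over the roots. *)
Lemma lower_half_roots (f : {poly R[i]}) :
  (forall t, 0 < complex.Im t -> f.[t] != 0) ->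
  normc f.[- 'i%C] <= normc f.['i%C].
Proof.
move=> fH; have [s fE] := closed_field_poly_normal f.
have [l0|l0] := eqVneq (lead_coef f) 0.
  by move/eqP: l0; rewrite lead_coef_eq0 => /eqP->; rewrite !horner0.
have sH z : z \in s -> complex.Im z <= 0.
  move=> zs; rewrite leNgt; apply/negP => /fH/eqP; apply.
  by apply/eqP; rewrite fE -/(root _ z) rootZ// root_prod_XsubC.
rewrite fE !hornerZ !normcM ler_wpM2l ?normc_ge0// {fE}.
elim: s sH => [|z s IH] sH; first by rewrite !big_nil !hornerC.
rewrite !big_cons !hornerM !normcM !hornerXsubC ler_pM ?normc_ge0//; last first.
  by apply: IH => w ws; apply: sH; rewrite inE ws orbT.
have := sH z (mem_head _ _); case: z {sH} => x y /= y0.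
rewrite ler_wsqrtr//; nra.
Qed.

(* On the complex line through z and its conjugate, p becomes a one-variable
   polynomial without roots in the upper half plane. *)
Lemma conj_poly2_le p z : (forall z, upper_half_bidisk z -> eval2 p z != 0) ->
  upper_half_bidisk z -> normc (eval2 (conj_poly2 p) z) <= normc (eval2 p z).
Proof.
move=> pH; case: z => [[x1 y1] [x2 y2]] [/= y10 y20].
(* The line reaches z at t = i and its conjugate at t = -i; positive slopes keep it in the domain
   for t in the upper half plane. *)
pose u (x y : R) : {poly R[i]} := x%:C%:P + y%:C *: 'X.
have uE x y a b : (u x y).[a +i* b] = (x + y * a) +i* (y * b).
  by rewrite /u !hornerE; simpc.
have := @lower_half_roots (curve_poly p (u x1 y1) (u x2 y2)).
rewrite eval2_conj_poly2 normcJ_eq/= !horner_curve_poly.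
rewrite -[- 'i%C]/((- 0) +i* (- 1)) !uE oppr0 !mulr0 !addr0 !mulrN !mulr1.
apply=> -[a b] /= b0; rewrite horner_curve_poly !uE; apply: pH.
by split; rewrite /= mulr_gt0.
Qed.
End ConjugateBound.

(** * Ideal membership: truncation and Neumann series *)

Section Ideal.
Variable R : realType.
Implicit Types p q d e : poly2 R.

Lemma coef2D p q i j : coef2 (p + q) i j = coef2 p i j + coef2 q i j.
Proof. by rewrite /coef2 !coefD. Qed.

Lemma coef2B p q i j : coef2 (p - q) i j = coef2 p i j - coef2 q i j.
Proof. by rewrite /coef2 !coefB. Qed.

Definition trunc2 (n : nat) (a : fps2 R) : poly2 R :=
  \poly_(j < n) \poly_(i < n) a i j.

Lemma coef2_trunc2 n a i j : (i < n)%N -> (j < n)%N ->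
  coef2 (trunc2 n a) i j = a i j.
Proof. by move=> ni nj; rewrite /coef2 coef_poly nj coef_poly ni. Qed.

Lemma norm2_trunc2 r n a : 0 <= r -> norm2 r (trunc2 n a) = square_sum r n a.
Proof.
move=> r0; rewrite (@norm2E _ r _ n)//; last first.
- rewrite /sizeY; apply/bigmax_leqP => j _; rewrite coef_poly.
  by case: ifP; rewrite ?size_poly ?size_poly0.
- exact: size_poly.
apply: eq_bigr => j _; apply: eq_bigr => i _.
by rewrite coef2_trunc2.
Qed.

(* Truncating the cofactors of an identity q = a p + b p' leaves an error of
   high order, which is exponentially small on a smaller bidisk. *)
Lemma ideal_bound p p' q : in_R0_ideal (coef2 p) (coef2 p') (coef2 q) ->
  exists K r : R, [/\ 0 <= K, 0 < r & forall z : C2 R,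
    normc z.1 < r -> normc z.2 < r ->
    normc (eval2 q z) <= K * normc (eval2 p z) + K * normc (eval2 p' z)].
Proof.
move=> [a [b [/convergent_seriesP[r1 [K1 [r10 aK]]]
  /convergent_seriesP[r2 [K2 [r20 bK]]] qE]]].
pose r := Num.min r1 r2; pose K := Num.max K1 K2.
have r0 : 0 < r by rewrite lt_min r10.
have {}aK n : square_sum r n a <= K.
  rewrite (le_trans (square_sum_radius n a (s := r1) _))// ?(ltW r0)/=
    ?ge_min ?lexx//.
  by rewrite le_max aK.
have {}bK n : square_sum r n b <= K.
  rewrite (le_trans (square_sum_radius n b (s := r2) _))// ?(ltW r0)/=
    ?ge_min ?lexx ?orbT//.
  by rewrite le_max bK orbT.
have K0 : 0 <= K by apply: le_trans (aK 0%N); rewrite /square_sum big_ord0.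
exists K, (2^-1 * r); split=> // [|z z1 z2]; first by rewrite mulr_gt0.
pose e n := q - (trunc2 n a * p + trunc2 n b * p').
have [S0 S_ge0 SD SM] := norm2_submult (ltW r0).
(* Coefficients of total degree below [n] in the products involve only entries that the truncation
   keeps. *)
have e_ord n : order_ge n (coef2 (e n)).
  move=> i j ij.
  have ltn k : (k <= i + j)%N -> (k < n)%N by move/leq_ltn_trans; apply.
  rewrite coef2B coef2D qE /fps2_add -!fps2_mul_coef2.
  rewrite (@eq_fps2_mul _ a (coef2 (trunc2 n a))).
    rewrite (@eq_fps2_mul _ b (coef2 (trunc2 n b))) ?subrr// => k l ki lj.
    by rewrite coef2_trunc2// ltn// (leq_trans ki, leq_trans lj)//
      (leq_addr, leq_addl).
  move=> k l ki lj.
  by rewrite coef2_trunc2// ltn// (leq_trans ki, leq_trans lj)//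
      (leq_addr, leq_addl).
(* [L] does not depend on [n], so at half the radius the error is at most [2^-1 ^+ n * L]. *)
pose L := norm2 r q + (K * norm2 r p + K * norm2 r p').
have e_norm n : norm2 r (e n) <= L.
  rewrite /e (le_trans (SD _ _))// norm2N lerD2l (le_trans (SD _ _))//.
  by rewrite lerD// (le_trans (SM _ _))// ler_wpM2r ?S_ge0// norm2_trunc2// ltW.
have zr w : normc w < 2^-1 * r -> normc w <= r.
  by move=> /ltW/le_trans; apply; rewrite ler_piMl ?(ltW r0)// invf_le1// ler1n.
have t_le n c : square_sum r n c <= K -> normc (eval2 (trunc2 n c) z) <= K.
  move=> cK; apply: le_trans cK; rewrite -norm2_trunc2 ?(ltW r0)//.
  by apply: eval2_le_norm2; rewrite ?zr// ltW.
have L0 : 0 <= L by rewrite addr_ge0 ?addr_ge0 ?mulr_ge0.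
have key n : normc (eval2 q z) <=
    K * normc (eval2 p z) + K * normc (eval2 p' z) + 2^-1 ^+ n * L.
  have -> : eval2 q z = (eval2 (trunc2 n a) z * eval2 p z +
      eval2 (trunc2 n b) z * eval2 p' z) + eval2 (e n) z.
    by rewrite /eval2 /e !(hornerD, hornerN, hornerM); ring.
  rewrite (le_trans (le_normcD _ _))// lerD//.
    rewrite (le_trans (le_normcD _ _))// !normcM.
    by rewrite lerD// ler_wpM2r ?normc_ge0// t_le.
  apply: le_trans (_ : norm2 (2^-1 * r) (e n) <= _).
    by apply: eval2_le_norm2; rewrite ?ltW// mulr_gt0.
  rewrite (le_trans (norm2_shrink (n := n) _ _ _))//; last first.
  - by rewrite ler_wpM2l// exprn_ge0// invr_ge0.
  - exact: ltW.
  - by rewrite invr_ge0 ler0n/= invf_le1// ler1n.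
apply/ler_addgt0Pr => c c0.
have [n nc] : exists n, L / c <= n%:R.
  by exists (Num.Def.archi_bound (L / c)); rewrite ltW// archi_boundP// divr_ge0// ltW.
apply: le_trans (key n) _; rewrite lerD2l exprVn mulrC ler_pdivrMr ?exprn_gt0//.
rewrite ler_pdivrMr// in nc; rewrite (le_trans nc)// mulrC ler_wpM2l ?(ltW c0)//.
by rewrite -natrX ler_nat ltnW// ltn_expl.
Qed.

Definition neumann e (n : nat) : poly2 R := iter n (fun g => 1 + e * g) 0.

Lemma neumannM e n : (1 - e) * neumann e n = 1 - e ^+ n.
Proof.
elim: n => [|n IH]; first by rewrite mulr0 expr0 subrr.
rewrite /neumann iterS -/(neumann e n) mulrDr mulr1 mulrCA IH exprS; ring.
Qed.

Lemma order_ge_expr e n : coef2 e 0 0 = 0 -> order_ge n (coef2 (e ^+ n)).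
Proof.
move=> e0; elim: n => [|n IH] //; rewrite exprS -add1n.
by apply: order_ge_mul => // -[|i] [|j].
Qed.

(** Each coefficient of the partial sums is eventually constant, which defines the limit series
    without any topology. *)
Lemma order_ge_neumannB e m n : coef2 e 0 0 = 0 -> (n <= m)%N ->
  order_ge n (coef2 (neumann e m - neumann e n)).
Proof.
move=> e0; elim: n m => [|n IH] [|m]// nm.
have -> : neumann e m.+1 - neumann e n.+1 = e * (neumann e m - neumann e n).
  by rewrite /neumann !iterS -/(neumann e m) -/(neumann e n); ring.
rewrite -add1n; apply: order_ge_mul; first by move=> [|i] [|j].
exact: IH.
Qed.

Lemma norm2_neumann r e n : 0 <= r -> norm2 r e <= 2^-1 ->
  norm2 r (neumann e n) <= 2.
Proof.
move=> r0 er; have [S0 S_ge0 SD SM] := norm2_submult r0.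
elim: n => [|n IH]; first by rewrite S0.
rewrite /neumann iterS -/(neumann e n) (le_trans (SD _ _))// norm2_1//.
have eS : norm2 r (e * neumann e n) <= 2^-1 * 2.
  by rewrite (le_trans (SM _ _))// ler_pM.
lra.
Qed.

(* The unit d is inverted by a Neumann series, which converges where
   the norm of 1 - d / d(0,0) is at most 1/2. *)
Lemma in_R0_ideal_of_unit p p' q d a b : d`_0`_0 != 0 ->
  d * q = a * p + b * p' -> in_R0_ideal (coef2 p) (coef2 p') (coef2 q).
Proof.
move=> d0 dq; pose k : poly2 R := ((d`_0`_0)^-1)%:P%:P.
pose e := 1 - k * d.
have e00 : coef2 e 0 0 = 0.
  by rewrite coef2B /coef2 /k !coefCM !coef1 mulr1n mulVf// subrr.
have eq : (1 - e) * q = (k * a) * p + (k * b) * p'.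
  by rewrite /e subKr -(mulrA k d) dq; ring.
(* As [e] has no constant term, its norm at radius [r] is at most [r * norm2 1 e], hence at most
   1/2. *)
pose r : R := (2 * (norm2 1 e + 1))^-1.
have [_ N_ge0 _ _] := norm2_submult (@ler01 R).
have N1 : 0 < norm2 1 e + 1 by rewrite ltr_pwDr.
have r0 : 0 < r by rewrite invr_gt0 mulr_gt0.
have re : norm2 r e <= 2^-1.
  have r1 : r <= 1 by rewrite invf_le1 ?mulr_gt0//; have := N_ge0 e; lra.
  have := @norm2_shrink R r 1 1 e; rewrite ler01 (ltW r0) r1 mulr1 expr1.
  move=> /(_ isT isT) h; apply: le_trans (h _) _; first by move=> [|i] [|j].
  rewrite /r invfM -mulrA ler_piMr ?invr_ge0// mulrC ler_pdivrMr//.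
  by rewrite mul1r lerDl.
(* This is the series of c/(1 - e): with [(i + j).+1] terms the coefficient at (i, j) is already
   stable. *)
pose s c : fps2 R := fun i j => coef2 (c * neumann e (i + j).+1) i j.
have sE c n i j : (i + j < n)%N -> s c i j = coef2 (c * neumann e n) i j.
  move=> ijn; apply/esym/eqP; rewrite -subr_eq0 -coef2B -mulrBr.
  apply/eqP; apply: (@order_ge_mul _ 0 (i + j).+1) => //.
  exact: order_ge_neumannB.
have s_conv c : convergent_series (s c).
  apply/convergent_seriesP; exists r, (norm2 r c * 2); split=> // n.
  have [_ R_ge0 _ RM] := norm2_submult (ltW r0).
  (* All indices in the square have sum below [n + n], so a single partial sum covers them and its
     norm is bounded uniformly. *)
  have -> : square_sum r n (s c) = square_sum r n (coef2 (c * neumann e (n + n))).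
    apply: eq_bigr => j _; apply: eq_bigr => i _.
    by rewrite (sE _ (n + n)%N)// -addnS leq_add// ltnW.
  rewrite (le_trans (square_sum_le_norm2 _ _ (ltW r0)))// (le_trans (RM _ _))//.
  by rewrite ler_wpM2l// norm2_neumann// ltW.
exists (s (k * a)), (s (k * b)); split=> //.
apply/funext => i; apply/funext => j; rewrite /fps2_add.
pose n := (i + j).+1.
have sn c x y : (x <= i)%N -> (y <= j)%N ->
    s c x y = coef2 (c * neumann e n) x y.
  by move=> xi yj; apply: sE; rewrite ltnS leq_add.
rewrite !(eq_fps2_mul _ (sn _)) !fps2_mul_coef2 -coef2D.
(* The telescoped remainder [e ^+ n * q] has order at least [n], above [i + j], so it does not reach
   the coefficient at (i, j). *)
have -> : k * a * neumann e n * p + k * b * neumann e n * p' = q - e ^+ n * q.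
  transitivity (((1 - e) * neumann e n) * q); last by rewrite neumannM; ring.
  by rewrite (mulrAC (1 - e)) eq; ring.
rewrite coef2B (_ : coef2 (e ^+ n * q) i j = 0) ?subr0//.
by apply: (@order_ge_mul _ n 0); [exact: order_ge_expr| |rewrite addn0].
Qed.
End Ideal.

Theorem theorem1p1 (R : realType) (p : poly2 R)
  (p_stable : pure_stable p) (p_order1 : vanishes_to_order p 1) (q : poly2 R) :
  locally_bounded_ratio q p <->
  in_R0_ideal (coef2 p) (coef2 (conj_poly2 p)) (coef2 q).
Proof.
have [pH nocf] := p_stable.
split=> [/(real_bound_of_locally_bounded pH) qp|/ideal_bound[K [r [K0 r0 Kr]]]].
  have [d [a [b [d0 dq]]]] := bounded_reduction p_order1 nocf qp.
  exact: in_R0_ideal_of_unit d0 dq.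
apply/locally_bounded_ratioP => //; exists (K + K), r; split=> // [|z zH z1 z2].
  exact: addr_ge0.
rewrite (le_trans (Kr z z1 z2))// mulrDl lerD2l ler_wpM2l//.
exact: conj_poly2_le.
Qed.
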